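(* The symmetric group $\Sigma_n$ is saturated if and only if $n\le 2$, and the alternating group $A_m$ is saturated if and only if $m\le 3$.
   Context: A $G$ transfer system $\mathcal{T}$ ($G$ a finite group) is a partial order $\to_{\mathcal{T}}$ on the set of subgroups of $G$ such that: $K\to_{\mathcal{T}}H$ implies $K\le H$; if $L\to_{\mathcal{T}}H$ and $K\le H$ then $K\cap L\to_{\mathcal{T}}K$; if $K\to_{\mathcal{T}}H$ and $g\in G$ then $gKg^{-1}\to_{\mathcal{T}}gHg^{-1}$. A transfer system $\mathcal{T}$ is saturated if whenever $L\le K\le H\le G$ and $L\to_{\mathcal{T}}H$, then $K\to_{\mathcal{T}}H$. A $G$-universe $\mathcal{U}$ is a countably infinite-dimensional real orthogonal $G$-representation which contains a non-zero subrepresentation on which $G$ acts trivially, and such that for every finite-dimensional subrepresentation $V\subset\mathcal{U}$ and every $n$, $V^{\oplus n}$ embeds in $\mathcal{U}$. The transfer system $\mathcal{T}_{\mathcal{L}(\mathcal{U})}$ (associated with the linear isometries operad) is given, for $K\le H\le G$, by: $K\to_{\mathcal{L}(\mathcal{U})}H$ iff $\mathrm{ind}^H_K\mathrm{res}^G_K\mathcal{U}$ embeds ($H$-equivariantly and linearly) into $\mathrm{res}^G_H\mathcal{U}$. A finite group $G$ is saturated if for each saturated $G$ transfer system $\mathcal{T}$ there exists a $G$-universe $\mathcal{U}$ with $\mathcal{T}=\mathcal{T}_{\mathcal{L}(\mathcal{U})}$. *)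

(* Defs.v *)
From HB Require Import structures.
From mathcomp Require Import all_boot all_order all_algebra all_fingroup all_solvable.
From mathcomp Require Import sesquilinear reals.

Set Implicit Arguments.
Unset Strict Implicit.
Unset Printing Implicit Defensive.

Import GroupScope GRing.Theory.
Local Open Scope ring_scope.

(* Following the conventions of mathcomp's mxrepresentation, G is a subgroup
   of an ambient finGroupType and the values of rep_act outside G are
   irrelevant; the action is on the left. *)
Record rep (R : realType) (gT : finGroupType) (G : {group gT}) := Rep {
  rep_mod :> lmodType R;
  rep_act : gT -> {linear rep_mod -> rep_mod};
  rep_act1 : forall v, rep_act 1%g v = v;
  rep_actM : {in G &, forall g h v, rep_act (g * h)%g v = rep_act g (rep_act h v)}
}.

Definition embeds (R : realType) (gT : finGroupType) (H : {group gT})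
    (V W : rep R H) : Prop :=
  exists phi : {linear V -> W}, injective phi /\
    {in H, forall h v, phi (rep_act V h v) = rep_act W h (phi v)}.

Section Restriction.
Variables (R : realType) (gT : finGroupType) (G K : {group gT}).

Lemma res_actM (sKG : K \subset G) (V : rep R G) :
  {in K &, forall g h v, rep_act V (g * h)%g v = rep_act V g (rep_act V h v)}.
Proof. by move=> g h Kg Kh v; apply: rep_actM; apply: (subsetP sKG). Qed.

Definition res (sKG : K \subset G) (V : rep R G) : rep R K :=
  Rep (@rep_act1 R gT G V) (@res_actM sKG V).

End Restriction.

Section Power.
Variables (R : realType) (gT : finGroupType) (G : {group gT}).
Variables (V : rep R G) (n : nat).

Definition pow_act (g : gT) (f : {ffun 'I_n -> V}) : {ffun 'I_n -> V} :=
  [ffun i => rep_act V g (f i)].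

Lemma pow_act_is_linear g : linear (pow_act g).
Proof. by move=> a u v; apply/ffunP=> i; rewrite !ffunE linearP. Qed.

HB.instance Definition _ g :=
  GRing.isLinear.Build R {ffun 'I_n -> V} {ffun 'I_n -> V} *:%R (pow_act g)
    (pow_act_is_linear g).

Lemma pow_act1 f : pow_act 1%g f = f.
Proof. by apply/ffunP=> i; rewrite ffunE rep_act1. Qed.

Lemma pow_actM :
  {in G &, forall g h f, pow_act (g * h)%g f = pow_act g (pow_act h f)}.
Proof. by move=> g h Gg Gh f; apply/ffunP=> i; rewrite !ffunE rep_actM. Qed.

Definition pow : rep R G :=
  @Rep R gT G {ffun 'I_n -> V} (fun g => pow_act g : {linear _ -> _})
    pow_act1 pow_actM.

End Power.

Section Subrepresentation.
Variables (R : realType) (gT : finGroupType) (G : {group gT}) (V : rep R G).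

Definition stable (S : submodClosed V) : Prop :=
  {in G, forall g v, v \in S -> rep_act V g v \in S}.

Variables (S : submodClosed V) (stS : stable S).

Definition subsp (S' : submodClosed V) : Type := {v : V | v \in S'}.
HB.instance Definition _ S' := SubChoice.on (subsp S').
HB.instance Definition _ S' := [SubChoice_isSubLmodule of subsp S' by <:].

(* S need not be stable under the irrelevant values of rep_act outside G. *)
Definition sub_act (g : gT) (v : subsp S) : subsp S :=
  if g \in G then insubd 0 (rep_act V g (val v)) else v.

Lemma val_sub_act g v : g \in G -> val (sub_act g v) = rep_act V g (val v).
Proof.
by move=> Gg; rewrite /sub_act Gg val_insubd stS //; apply: valP.
Qed.

Lemma sub_act_is_linear g : linear (sub_act g).
Proof.
move=> a u v; have [Gg|nGg] := boolP (g \in G); last first.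
  by rewrite /sub_act (negPf nGg).
by apply: val_inj; rewrite val_sub_act // !linearP /= !val_sub_act.
Qed.

HB.instance Definition _ g :=
  GRing.isLinear.Build R (subsp S) (subsp S) *:%R (sub_act g)
    (sub_act_is_linear g).

Lemma sub_act1 v : sub_act 1%g v = v.
Proof. by apply: val_inj; rewrite val_sub_act ?group1 // rep_act1. Qed.

Lemma sub_actM :
  {in G &, forall g h v, sub_act (g * h)%g v = sub_act g (sub_act h v)}.
Proof.
by move=> g h Gg Gh v; apply: val_inj; rewrite !val_sub_act ?groupM ?rep_actM.
Qed.

Definition subrep : rep R G :=
  @Rep R gT G (subsp S) (fun g => sub_act g : {linear _ -> _}) sub_act1 sub_actM.

End Subrepresentation.

Section Induction.
Variables (R : realType) (gT : finGroupType) (K H : {group gT}) (V : rep R K).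

(* The model of ind_K^H V given by the functions f : H -> V (extended by 0 to
   the ambient group) with f (k x) = k (f x) for k in K and x in H, on which
   h in H acts by (h f) x = f (x h). For finite H and K <= H this is
   R[H] (x)_R[K] V: see ind_universal below. *)
Definition ind_pred : {pred {ffun gT -> V}} := [pred f : {ffun gT -> V} |
  [forall x, (x \notin H) ==> (f x == 0)] &&
  [forall k in K, forall x in H, f (k * x)%g == rep_act V k (f x)]].

Lemma ind_predP (f : {ffun gT -> V}) :
  reflect ((forall x, x \notin H -> f x = 0) /\
           {in K & H, forall k x, f (k * x)%g = rep_act V k (f x)})
          (f \in ind_pred).
Proof.
apply: (iffP andP) => [[/forallP f0 /forall_inP fK] | [f0 fK]]; split.
- by move=> x /(implyP (f0 x))/eqP.
- by move=> k x Kk Hx; have /forall_inP/(_ x Hx)/eqP := fK k Kk.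
- by apply/forallP=> x; apply/implyP=> /f0->.
- by apply/forall_inP=> k Kk; apply/forall_inP=> x Hx; rewrite fK.
Qed.

Lemma ind_pred_submod : submod_closed ind_pred.
Proof.
split=> [|a f1 f2 /ind_predP[f10 f1K] /ind_predP[f20 f2K]]; apply/ind_predP.
  by split=> [x _|k x _ _]; rewrite !ffunE ?linear0.
split=> [x Hx|k x Kk Hx]; rewrite !ffunE.
  by rewrite f10 // f20 // scaler0 addr0.
by rewrite f1K // f2K // linearP.
Qed.
HB.instance Definition _ :=
  GRing.isSubmodClosed.Build R {ffun gT -> V} ind_pred ind_pred_submod.

Definition ind_mod : Type := {f : {ffun gT -> V} | f \in ind_pred}.
HB.instance Definition _ := SubChoice.on ind_mod.
HB.instance Definition _ := [SubChoice_isSubLmodule of ind_mod by <:].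

Definition ind_act (h : gT) (f : ind_mod) : ind_mod :=
  if h \in H then insubd 0 [ffun x => val f (x * h)%g] else f.

Lemma val_ind_act h f x : h \in H -> val (ind_act h f) x = val f (x * h)%g.
Proof.
move=> Hh; rewrite /ind_act Hh val_insubd ifT ?ffunE //.
have /ind_predP[f0 fK] := valP f; apply/ind_predP; split=> [y Hy|k y Kk Hy].
  by rewrite ffunE f0 // groupMr.
by rewrite !ffunE -mulgA fK // groupM.
Qed.

Lemma ind_act_is_linear h : linear (ind_act h).
Proof.
move=> a u v; have [Hh|nHh] := boolP (h \in H); last first.
  by rewrite /ind_act (negPf nHh).
apply/val_inj/ffunP=> x; rewrite val_ind_act // !linearP /= !ffunE.
by rewrite !val_ind_act.
Qed.

HB.instance Definition _ h :=
  GRing.isLinear.Build R ind_mod ind_mod *:%R (ind_act h) (ind_act_is_linear h).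

Lemma ind_act1 f : ind_act 1%g f = f.
Proof.
by apply/val_inj/ffunP=> x; rewrite val_ind_act ?group1 // mulg1.
Qed.

Lemma ind_actM :
  {in H &, forall g h f, ind_act (g * h)%g f = ind_act g (ind_act h f)}.
Proof.
move=> g h Hg Hh f; apply/val_inj/ffunP=> x.
by rewrite !val_ind_act ?groupM // mulgA.
Qed.

Definition ind : rep R H :=
  @Rep R gT H ind_mod (fun h => ind_act h : {linear _ -> _}) ind_act1 ind_actM.

(* v |-> 1 (x) v *)
Definition ind_unit (v : V) : ind :=
  insubd (0 : ind_mod) [ffun x => if x \in K then rep_act V x v else 0].

End Induction.

Section InductionUniversal.
Variables (R : realType) (gT : finGroupType) (K H : {group gT}).
Variables (sKH : K \subset H) (V : rep R K).

Lemma val_ind_unit v x :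
  val (ind_unit H v : ind_mod H V) x = if x \in K then rep_act V x v else 0.
Proof.
rewrite /ind_unit val_insubd ifT ?ffunE //; apply/ind_predP.
split=> [y|k y Kk Hy]; rewrite !ffunE.
  by move=> Hy; rewrite (contraNF (subsetP sKH y)).
by rewrite groupMl //; case: ifP => Ky; [rewrite rep_actM | rewrite linear0].
Qed.

Lemma val_ind_linear a (u v : ind_mod H V) x :
  val (a *: u + v) x = a *: val u x + val v x.
Proof. by rewrite linearP !ffunE. Qed.

Lemma ind_sum (f : ind H V) : (#|K|%:R : R) *: f =
  \sum_(x in H) rep_act (ind H V) x^-1%g (ind_unit H (val (f : ind_mod H V) x)).
Proof.
have /ind_predP[f0 fK] := valP (f : ind_mod H V).
apply: (@val_inj _ _ (ind_mod H V)); apply/ffunP=> y.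
rewrite linearZ linear_sum /= sum_ffunE ffunE.
have [Hy|nHy] := boolP (y \in H); last first.
  rewrite f0 // scaler0 big1 // => x Hx.
  rewrite val_ind_act ?groupV // val_ind_unit.
  rewrite (contraNF (subsetP sKH _)) // groupMr ?groupV //.
transitivity (\sum_(x in H | (y * x^-1)%g \in K) val (f : ind_mod H V) y).
  rewrite sumr_const scaler_nat; congr (_ *+ _).
  rewrite -(card_rcoset K y); apply: eq_card => x; rewrite mem_rcoset unfold_in /=.
  have -> : (x * y^-1 = (y * x^-1)^-1)%g by rewrite invMg invgK.
  rewrite groupV andb_idl // => Kyx; rewrite -groupV -(groupMl _ Hy).
  exact: (subsetP sKH).
rewrite big_mkcondr /=; apply: eq_bigr => x Hx.
rewrite val_ind_act ?groupV // val_ind_unit; case: ifP => // Kyx.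
by rewrite -fK // mulgKV.
Qed.

Lemma ind_universal (W : rep R H) (phi : {linear V -> W}) :
  {in K, forall k v, phi (rep_act V k v) = rep_act W k (phi v)} ->
  exists2 psi : {linear ind H V -> W},
    {in H, forall h f, psi (rep_act (ind H V) h f) = rep_act W h (psi f)} /\
    (forall v, psi (ind_unit H v) = phi v)
  & forall psi' : {linear ind H V -> W},
    {in H, forall h f, psi' (rep_act (ind H V) h f) = rep_act W h (psi' f)} ->
    (forall v, psi' (ind_unit H v) = phi v) -> psi' =1 psi.
Proof.
move=> phiK; have K0 : #|K|%:R != 0 :> R.
  by rewrite Num.Theory.pnatr_eq0 -lt0n cardG_gt0.
pose psi (f : ind H V) : W := (#|K|%:R : R)^-1 *:
  \sum_(x in H) rep_act W x^-1%g (phi (val (f : ind_mod H V) x)).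
have psi_lin : linear psi.
  move=> a u v; rewrite /psi scalerA mulrC -scalerA -scalerDr; congr (_ *: _).
  rewrite scaler_sumr -big_split; apply: eq_bigr => x _ /=.
  have -> : val ((a *: u + v : ind H V) : ind_mod H V) x =
      a *: val (u : ind_mod H V) x + val (v : ind_mod H V) x.
    by rewrite [LHS](val_ind_linear a u v).
  by rewrite !linearP.
pose psiL := GRing.isLinear.Build R _ _ *:%R psi psi_lin.
pose psi_ : {linear ind H V -> W} := HB.pack psi psiL.
exists psi_; first split.
- move=> h Hh f; rewrite /= /psi [RHS]linearZ /=; congr (_ *: _); rewrite linear_sum /=.
  rewrite (reindex_inj (mulIg h^-1%g)); apply: eq_big => [x|x].
    by rewrite groupMr ?groupV.
  rewrite groupMr ?groupV // => Hx.
  by rewrite val_ind_act // mulgKV invMg invgK rep_actM ?groupV.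
- move=> v; rewrite /= /psi (bigID (mem K)) /= [X in _ + X]big1 => [|x].
    rewrite addr0 (eq_bigr (fun=> phi v)) => [|x /andP[Hx Kx]].
      rewrite sumr_const -[phi v *+ _]scaler_nat scalerA.
      have -> : #|[pred i | (i \in H) && (i \in K)]| = #|K|.
        by apply: eq_card => x; rewrite inE andb_idl //; apply: (subsetP sKH).
      by rewrite mulVf ?scale1r.
    rewrite val_ind_unit Kx phiK // -rep_actM ?groupV //.
    by rewrite mulVg rep_act1.
  by case/andP=> _ nKx; rewrite val_ind_unit (negPf nKx) !linear0.
- move=> psi' psi'H psi'V f; rewrite /= /psi.
  apply: (scalerI K0); rewrite scalerA divff // scale1r -linearZ ind_sum.
  rewrite linear_sum; apply: eq_bigr => x Hx.
  by rewrite psi'H ?groupV // psi'V.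
Qed.

End InductionUniversal.

Definition finite_dimensional (R : realType) (V : lmodType R) : Prop :=
  exists (n : nat) (e : 'I_n -> V), forall v : V,
    exists c : 'I_n -> R, v = \sum_(i < n) c i *: e i.

Definition countably_infinite_dimensional (R : realType) (V : lmodType R) : Prop :=
  exists e : nat -> V,
    (forall (n : nat) (c : 'I_n -> R),
       \sum_(i < n) c i *: e i = 0 -> forall i, c i = 0) /\
    (forall v : V, exists (n : nat) (c : 'I_n -> R),
       v = \sum_(i < n) c i *: e i).

Record universe (R : realType) (gT : finGroupType) (G : {group gT}) := Universe {
  univ_rep :> rep R G;
  univ_dot : {dot univ_rep for idfun};
  univ_orthogonal : {in G, forall g u v,
    univ_dot (rep_act univ_rep g u) (rep_act univ_rep g v) = univ_dot u v};
  univ_dim : countably_infinite_dimensional univ_rep;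
  univ_trivial : exists S : submodClosed univ_rep,
    [/\ stable S, exists2 v, v \in S & v != 0
      & {in G, forall g v, v \in S -> rep_act univ_rep g v = v}];
  univ_pow : forall (S : submodClosed univ_rep) (stS : stable S),
    finite_dimensional (subrep stS) ->
    forall n : nat, embeds (pow (subrep stS) n) univ_rep
}.

(* Only the values of T on subgroups of G are relevant. *)
Record transfer_system (gT : finGroupType) (G : {group gT})
    (T : {group gT} -> {group gT} -> Prop) : Prop := TransferSystem {
  ts_refl : forall H : {group gT}, H \subset G -> T H H;
  ts_anti : forall K H : {group gT}, K \subset G -> H \subset G ->
    T K H -> T H K -> K = H;
  ts_trans : forall L K H : {group gT},
    L \subset G -> K \subset G -> H \subset G -> T L K -> T K H -> T L H;
  ts_sub : forall K H : {group gT}, K \subset G -> H \subset G ->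
    T K H -> K \subset H;
  ts_res : forall L K H : {group gT},
    L \subset G -> K \subset G -> H \subset G ->
    T L H -> K \subset H -> T (K :&: L)%G K;
  ts_conj : forall (K H : {group gT}) (g : gT),
    K \subset G -> H \subset G -> g \in G ->
    T K H -> T (K :^ g^-1)%G (H :^ g^-1)%G
}.

Definition saturated_ts (gT : finGroupType) (G : {group gT})
    (T : {group gT} -> {group gT} -> Prop) : Prop :=
  transfer_system G T /\
  forall L K H : {group gT}, L \subset K -> K \subset H -> H \subset G ->
    T L H -> T K H.

Definition isometries_ts (R : realType) (gT : finGroupType) (G : {group gT})
    (U : universe R G) (K H : {group gT}) : Prop :=
  exists (sKH : K \subset H) (sHG : H \subset G),
    embeds (ind H (res (subset_trans sKH sHG) U)) (res sHG U).

Definition saturated_group (R : realType) (gT : finGroupType) (G : {group gT}) : Prop :=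
  forall T : {group gT} -> {group gT} -> Prop, saturated_ts G T ->
  exists U : universe R G, forall K H : {group gT},
    K \subset G -> H \subset G -> (T K H <-> isometries_ts U K H).

(* Main.v *)
(* A finite group with elements q, y such that #[q] <= 3 and c = [q, y] has prime
   order different from #[q] is not saturated: the transfer system whose only
   nontrivial arrows are 1 -> <c> and its conjugates is not realized. Indeed
   1 -> <c> forces c, hence q, to act nontrivially on the universe U. Since
   #[q] <= 3 and U contains a trivial line, U restricted to <q> then contains the
   regular representation, hence infinitely many copies of it, so 1 -> <q> holds.
   In Sym take transpositions q, y whose commutator is a 3-cycle; in Alt take a
   3-cycle q such that c is a double transposition. If #|G| <= 3, the only
   possible arrow is 1 -> G, and a trivial universe or a multiple of the regular
   representation realizes either choice. *)

From HB Require Import structures.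
From mathcomp Require Import all_boot all_order all_algebra all_fingroup all_solvable.
From mathcomp Require Import sesquilinear reals boolp.
Require Import Defs.

Set Implicit Arguments.
Unset Strict Implicit.
Unset Printing Implicit Defensive.

Section Development.

Import GroupScope Order.TTheory GRing.Theory Num.Theory.
Local Open Scope ring_scope.

(** * Groups of order at most 3 *)

Lemma subgroup_of_card_le3 (gT : finGroupType) (G K : {group gT}) :
  (#|G| <= 3)%N -> K \subset G -> K = 1%G \/ K = G.
Proof.
move=> G3 sKG; have [K1|ntK] := eqVneq K 1%G; [by left | right].
apply/val_inj/eqP; rewrite eqEcard sKG /=.
have K_gt1 : (1 < #|K|)%N.
  by rewrite cardG_gt1; apply: contraNneq ntK => K1; apply/eqP/val_inj.
have /dvdnP[[|[|k]] oG] := cardSg sKG; [|by rewrite oG mul1n|].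
  by have := cardG_gt0 G; rewrite oG.
by move: G3; rewrite oG leqNgt (@leq_trans (k.+2 * 2)) ?leq_mul2l // mulnC.
Qed.

(** Used to show that the Gram matrix of a [Q]-orbit is constant off the diagonal: an invariant
    symmetric form takes the same value on [x] and on its inverse. *)
Lemma eq_or_inv_of_card_le3 (gT : finGroupType) (Q : {group gT}) (x y : gT) :
    (#|Q| <= 3)%N -> x \in Q -> y \in Q -> x != 1%g -> y != 1%g ->
  y = x \/ y = x^-1%g.
Proof.
move=> Q3 Qx Qy x1 y1.
have xQ : <[x]>%g = Q.
  have sxQ : <[x]>%G \subset Q by rewrite cycle_subG.
  have [/(congr1 val)/= xE|/(congr1 val)//] := subgroup_of_card_le3 Q3 sxQ.
  by have := cycle_id x; rewrite xE inE (negPf x1).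
have ox : (#[x] <= 3)%N by rewrite orderE xQ.
have : y \in <[x]>%g by rewrite xQ.
case/cyclePmin=> [[|[|[|m]]] ltm Dy].
- by rewrite Dy expg0 eqxx in y1.
- by left; rewrite Dy expg1.
- right; rewrite invg_expg Dy; congr (_ ^+ _)%g.
  by case: #[x] ltm ox => [|[|[|[|]]]].
- by have := leq_trans ltm ox.
Qed.

(** * Coordinates in a countable basis *)

Section LinearCombinations.
Variables (R : realType) (V : lmodType R).

(** A polynomial stands for a finitely supported sequence of coefficients. *)
Definition lincomb (e : nat -> V) (p : {poly R}) : V :=
  \sum_(i < size p) p`_i *: e i.

Lemma lincombE e n (p : {poly R}) :
  (size p <= n)%N -> lincomb e p = \sum_(i < n) p`_i *: e i.
Proof.
move=> le_n; rewrite /lincomb (big_ord_widen n (fun i => p`_i *: e i)) //.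
rewrite big_mkcond; apply: eq_bigr => i _; case: ltnP => // le_i.
by rewrite nth_default // scale0r.
Qed.

Lemma lincomb_is_linear e : linear (lincomb e).
Proof.
move=> a p q; pose n := maxn (size (a *: p + q)) (maxn (size p) (size q)).
rewrite !(@lincombE e n) ?leq_max ?leqnn ?orbT // scaler_sumr -big_split.
by apply: eq_bigr => i _; rewrite coefD coefZ scalerDl scalerA.
Qed.

HB.instance Definition _ e :=
  GRing.isLinear.Build R {poly R} V *:%R (lincomb e) (lincomb_is_linear e).

(** For a basis [e] the map [lincomb e] is bijective; [theta] is its inverse, obtained by choice. *)
Lemma poly_coordinates : countably_infinite_dimensional V ->
  exists theta : {linear V -> {poly R}}, injective theta.
Proof.
case=> e [e_free e_span].
have lin_inj : injective (lincomb e).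
  apply: raddf_inj => p p0; apply/polyP => i; rewrite coef0.
  have [lt_i|] := ltnP i (size p); last by move/(nth_default _)->.
  exact: (e_free _ (fun i : 'I_(size p) => p`_i) p0 (Ordinal lt_i)).
have /choice[theta thetaK] v : exists p, lincomb e p = v.
  have [n [c ->]] := e_span v.
  exists (\poly_(i < n) (if insub i is Some j then c j else 0)).
  rewrite (lincombE _ (size_poly _ _)); apply: eq_bigr => i _.
  by rewrite coef_poly ltn_ord valK.
have theta_lin : linear theta.
  by move=> a u v; apply: lin_inj; rewrite [RHS]linearP /= !thetaK.
pose thetaL := GRing.isLinear.Build R _ _ *:%R theta theta_lin.
by exists (HB.pack theta thetaL : {linear V -> {poly R}}); apply: can_inj thetaK.
Qed.

End LinearCombinations.

(** * Free orbits in a universe and arrows from the trivial subgroup *)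

Section UniverseTheory.
Variables (R : realType) (gT : finGroupType) (G : {group gT}) (U : universe R G).
Local Notation "''[' u , v ]" := (univ_dot U u v) : ring_scope.
Local Notation act := (rep_act U).
Implicit Types (u v w : U) (Q : {group gT}).

Lemma udotC u v : '[u, v] = '[v, u].
Proof. by rewrite hermC /= expr0 mul1r. Qed.

Lemma udotZr a u v : '[u, a *: v] = a * '[u, v].
Proof. exact: linearZr_LR. Qed.

Lemma udotDr u v w : '[u, v + w] = '[u, v] + '[u, w].
Proof. exact: linearDr. Qed.

Lemma udot_sumr I r (P : pred I) u (F : I -> U) :
  '[u, \sum_(i <- r | P i) F i] = \sum_(i <- r | P i) '[u, F i].
Proof. exact: linear_sumr. Qed.

Lemma udot_eq0 u : '[u, u] = 0 -> u = 0.
Proof.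
move=> uu0; apply/eqP/contraT => /(neq0_dnorm_gt0 (s:=univ_dot U)).
by rewrite uu0 ltxx.
Qed.

Lemma actK g v : g \in G -> act g^-1%g (act g v) = v.
Proof. by move=> Gg; rewrite -rep_actM ?groupV // mulVg rep_act1. Qed.

Lemma udot_act g u v : g \in G -> '[act g u, v] = '[u, act g^-1%g v].
Proof.
by move=> Gg; rewrite -(univ_orthogonal (groupVr Gg)) actK.
Qed.

Lemma fixed_vector_exists :
  exists2 t : U, t != 0 & {in G, forall g, act g t = t}.
Proof.
have [S [_ [t St t0] fixS]] := univ_trivial U.
by exists t => // g Gg; rewrite fixS.
Qed.

(** For [Q] inside [G] this says that the [Q]-orbit of [u] spans a copy of the regular
    representation of [Q]. *)
Definition free_orbit Q u := forall a : gT -> R,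
  \sum_(x in Q) a x *: act x u = 0 -> {in Q, forall x, a x = 0}.

(** The vector [s = v - q v] has orbit sum 0, and this is, up to scalars, the only linear relation
    in its orbit. Adding a fixed vector [t], which is orthogonal to that orbit, destroys the
    relation. *)
Lemma free_orbit_exists Q q v :
    Q \subset G -> (#|Q| <= 3)%N -> q \in Q -> act q v != v ->
  exists u, free_orbit Q u.
Proof.
move=> /subsetP sQG Q3 Qq qv; have [t t0 tfix] := fixed_vector_exists.
have Gq := sQG _ Qq.
pose s := v - act q v; pose b := '[s, act q s].
have q1 : q != 1%g by apply: contraNneq qv => ->; rewrite rep_act1.
have sum_s : \sum_(x in Q) act x s = 0.
  under eq_bigr do rewrite linearB.
  rewrite sumrB [X in _ - X](reindex_inj (mulIg q^-1%g)) /=.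
  apply/eqP; rewrite subr_eq0; apply/eqP/eq_big => [x|x Qx].
    by rewrite groupMr ?groupV.
  by rewrite -rep_actM ?mulgKV // groupM ?groupV // sQG.
have gram x : x \in Q -> x != 1%g -> '[s, act x s] = b.
  move=> Qx x1; have [->//|->] := eq_or_inv_of_card_le3 Q3 Qq Qx q1 x1.
  by rewrite -udot_act // udotC.
have ts0 x : x \in Q -> '[t, act x s] = 0.
  move=> Qx; have tx y : y \in Q -> '[t, act y s] = '[t, s].
    by move=> Qy; rewrite -{1}(tfix y) ?univ_orthogonal ?sQG.
  have: '[t, \sum_(y in Q) act y s] = 0 by rewrite sum_s linear0r.
  rewrite udot_sumr (eq_bigr _ tx) sumr_const => /eqP.
  rewrite mulrn_eq0 -[_ == 0%N]negbK -lt0n cardG_gt0 /= => /eqP ts.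
  by rewrite tx.
have ss_b : '[s, s] = - b *+ #|Q|.-1.
  have: '[s, \sum_(y in Q) act y s] = 0 by rewrite sum_s linear0r.
  rewrite udot_sumr (bigD1 1%g) //= rep_act1 (eq_bigr (fun=> b)) => [|y].
    rewrite sumr_const (cardD1 1%g Q) group1 /= => /eqP.
    rewrite addr_eq0 -mulNrn => /eqP->; congr (_ *+ _).
    by apply: eq_card => y; rewrite !inE andbC.
  by case/andP=> Qy y1; apply: gram.
have s0 : s != 0 by rewrite subr_eq0 eq_sym.
have ss_gt0 : 0 < '[s, s] by apply: neq0_dnorm_gt0.
(* If ['[s, s] = b], then [b] is positive, while [ss_b] makes ['[s, s]] nonpositive. *)
have sb : '[s, s] - b != 0.
  apply/negP; rewrite subr_eq0 => /eqP e; move: (ss_gt0).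
  by rewrite ss_b mulNrn oppr_gt0 ltNge mulrn_wge0 // -e ltW.
(* t is orthogonal to the Q-orbit of s, whose Gram matrix is constant off the
   diagonal. *)
exists (t + s) => a rel.
have {rel} rel : (\sum_(x in Q) a x) *: t + \sum_(x in Q) a x *: act x s = 0.
  rewrite -[RHS]rel scaler_suml -big_split; apply: eq_bigr => x Qx /=.
  by rewrite [act x (t + s)]linearD tfix ?sQG // scalerDr.
have sum_a : \sum_(x in Q) a x = 0.
  have: '[t, (\sum_(x in Q) a x) *: t + \sum_(x in Q) a x *: act x s] = 0.
    by rewrite rel linear0r.
  rewrite udotDr udot_sumr [X in _ + X]big1 => [|x Qx]; last first.
    by rewrite udotZr ts0 // mulr0.
  rewrite addr0 udotZr => /eqP; rewrite mulf_eq0 => /orP[/eqP//|].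
  by rewrite (gt_eqF (neq0_dnorm_gt0 (s:=univ_dot U) t t0)).
move=> y Qy; rewrite sum_a scale0r add0r in rel.
have: '[act y s, \sum_(x in Q) a x *: act x s] = 0 by rewrite rel linear0r.
rewrite udot_sumr.
(* The Gram matrix is [b] times the all-ones matrix plus ['[s, s] - b] times the identity. By
   [sum_a] the first summand contributes 0, so only [a y] survives. *)
rewrite (eq_bigr (fun x =>
    a x * b + (if x == y then a x * ('[s, s] - b) else 0))).
  rewrite big_split /= -mulr_suml sum_a mul0r add0r -big_mkcondr /=.
  rewrite (big_pred1 y) => [|x]; last by rewrite inE andb_idl // => /eqP->.
  by move/eqP; rewrite mulf_eq0 (negPf sb) orbF => /eqP.
move=> x Qx; rewrite udotZr udot_act ?sQG // -rep_actM ?groupV ?sQG //.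
have [->|neq] := eqVneq.
  by rewrite mulVg rep_act1 -mulrDr addrCA subrr addr0.
by rewrite gram ?addr0 ?groupM ?groupV // -eq_mulVg1 eq_sym.
Qed.


(** The orbit is taken under all of [G], not only under [Q], because [univ_pow] speaks of [G]-stable
    subspaces. *)
Definition orbit_span u : {pred U} :=
  [pred v | `[< exists a : gT -> R, v = \sum_(g in G) a g *: act g u >]].

Lemma orbit_span_submod_closed u : submod_closed (orbit_span u).
Proof.
split=> [|b v w /asboolP[a1 ->] /asboolP[a2 ->]]; apply/asboolP.
  by exists (fun=> 0); rewrite big1 // => g _; rewrite scale0r.
exists (fun g => b * a1 g + a2 g); rewrite scaler_sumr -big_split.
by apply: eq_bigr => g _; rewrite scalerDl scalerA.
Qed.

HB.instance Definition _ u :=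
  GRing.isSubmodClosed.Build R U (orbit_span u) (orbit_span_submod_closed u).

Lemma mem_orbit_span g u : g \in G -> act g u \in orbit_span u.
Proof.
move=> Gg; apply/asboolP; exists (fun x => (x == g)%:R).
rewrite (bigD1 g) //= eqxx scale1r big1 ?addr0 // => x /andP[_ /negPf->].
exact: scale0r.
Qed.

Lemma stable_orbit_span u : stable (orbit_span u : submodClosed U).
Proof.
move=> g Gg v /asboolP[a ->]; rewrite linear_sum; apply: rpred_sum => x Gx.
by rewrite linearZ rpredZ //= -rep_actM // mem_orbit_span ?groupM.
Qed.

Lemma orbit_span_finite_dimensional u :
  finite_dimensional (subrep (@stable_orbit_span u)).
Proof.
exists #|G|; exists (fun i : 'I_#|G| =>
  exist (fun v => v \in orbit_span u) _ (mem_orbit_span u (enum_valP i))) => v.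
have /asboolP[a va] := valP v; exists (fun i => a (enum_val i)); apply: val_inj.
by rewrite va big_enum_val linear_sum; apply: eq_bigr => i _; rewrite linearZ.
Qed.

(* An embedding in U of n copies of the span of the orbit of u contains an
   n-parameter family of copies of u; for n > size W one is orthogonal to W. *)
Lemma free_orbit_orthogonal Q u (W : seq U) :
    Q \subset G -> free_orbit Q u ->
  exists2 u', free_orbit Q u' & {in W, forall w, '[w, u'] = 0}.
Proof.
move=> /subsetP sQG u_free; set n := size W.
have Su : u \in orbit_span u.
  by rewrite -[X in X \in _](rep_act1 u) mem_orbit_span.
pose S := subrep (@stable_orbit_span u); pose su : S := exist _ u Su.
have [phi [phi_inj phi_act]] :=
  univ_pow (@orbit_span_finite_dimensional u) n.+1.
pose copy (j : 'I_n.+1) : pow S n.+1 := [ffun k => if k == j then su else 0].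
pose M := \matrix_(j < n.+1, i < n) '[W`_i, phi (copy j)].
(* [M] has one more row than columns, so its left kernel is nonzero. *)
have [x /sub_kermxP xM x0] : exists2 x : 'rV_n.+1, (x <= kermx M)%MS & x != 0.
  apply/rowV0Pn; rewrite -mxrank_eq0 mxrank_ker -lt0n subn_gt0 ltnS.
  exact: rank_leq_col.
(* [F] is the diagonal copy of [S] with weights [x]. It is injective because some weight is nonzero,
   and [F su] is the combination of the [copy j] that [xM] makes orthogonal to [W]. *)
pose F (v : S) : pow S n.+1 := [ffun k => x 0 k *: v].
exists (phi (F su)) => [a rel | w Ww].
  apply: u_free; have [k xk] : exists k, x 0 k != 0.
    by apply/existsP; apply: contraNT x0 => /existsPn x0; apply/eqP/rowP=> k;
       rewrite mxE; apply/eqP; have := x0 k; rewrite negbK.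
  have : F (\sum_(g in Q) a g *: rep_act S g su) = 0.
    apply: phi_inj; rewrite linear0 -rel.
    transitivity (phi (\sum_(g in Q) a g *: F (rep_act S g su))).
      congr (phi _); apply/ffunP=> i; rewrite sum_ffunE ffunE scaler_sumr.
      by apply: eq_bigr => g _; rewrite !ffunE !scalerA mulrC.
    rewrite linear_sum; apply: eq_bigr => g Qg; rewrite linearZ /=.
    congr (_ *: _); rewrite -phi_act ?sQG //; congr (phi _).
    by apply/ffunP=> i; rewrite !ffunE linearZ.
  move/ffunP/(_ k); rewrite !ffunE => /eqP; rewrite scaler_eq0 (negPf xk) /=.
  move/eqP/(congr1 val); rewrite linear_sum /= => rel'; rewrite -[RHS]rel'.
  apply: eq_bigr => g Qg.
  by rewrite -[sval _]/(val _) (val_sub_act (@stable_orbit_span u)) ?sQG.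
have ltw : (index w W < n)%N by rewrite index_mem.
have := congr1 (fun N : 'rV_n => N 0 (Ordinal ltw)) xM; rewrite !mxE => xM0.
rewrite -[RHS]xM0; have -> : F su = \sum_j x 0 j *: copy j.
  apply/ffunP=> k; rewrite sum_ffunE !ffunE (bigD1 k) //= big1 => [|j neq].
    by rewrite !ffunE eqxx addr0.
  by rewrite !ffunE eq_sym (negPf neq) scaler0.
rewrite linear_sum udot_sumr; apply: eq_bigr => j _.
by rewrite linearZ udotZr mxE /= nth_index.
Qed.


Lemma orthogonal_free_orbits Q u : Q \subset G -> free_orbit Q u ->
  exists us : nat -> U, (forall i, free_orbit Q (us i)) /\
    forall i j, i != j ->
      {in Q &, forall x y, '[act x (us i), act y (us j)] = 0}.
Proof.
move=> sQG u_free.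
pose f W := s2val (cid2 (free_orbit_orthogonal W sQG u_free)).
have f_free W : free_orbit Q (f W) by rewrite /f; case: cid2.
have f_ortho W : {in W, forall w, '[w, f W] = 0} by rewrite /f; case: cid2.
(* The whole [Q]-orbit of each new vector joins the list. By invariance of the dot product, a later
   vector orthogonal to that orbit has its own orbit orthogonal to it. *)
pose next W := W ++ [seq act x (f W) | x <- enum Q].
pose L n := iter n next [::].
have L_mono i j : (i <= j)%N -> {subset L i <= L j}.
  elim: j => [|j IHj]; first by rewrite leqn0 => /eqP->.
  rewrite leq_eqVlt => /predU1P[->//|/IHj sub w /sub Lw].
  by rewrite /= mem_cat Lw.
have ortho i j x y : (i < j)%N -> x \in Q -> y \in Q ->
    '[act x (f (L i)), act y (f (L j))] = 0.
  move=> ltij Qx Qy; rewrite udotC udot_act ?(subsetP sQG) //.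
  rewrite -rep_actM ?groupV ?(subsetP sQG) // udotC.
  apply: f_ortho; apply: (L_mono i.+1) => //=.
  rewrite mem_cat orbC (map_f (fun z => act z (f (L i)))) //.
  by rewrite mem_enum groupM ?groupV.
exists (f \o L); split=> [i|i j neq x y Qx Qy]; first exact: f_free.
have [ltij|ltji|/eqP] := ltngtP i j; [exact: ortho| |by rewrite (negPf neq)].
by rewrite udotC; apply: ortho.
Qed.

(** Inducing [U] from the trivial group to [Q] gives countably many regular representations, one for
    each basis vector of [U]. Pairwise orthogonal free orbits provide room for all of them. *)
Lemma isometries_of_free_orbit Q u : Q \subset G -> free_orbit Q u ->
  isometries_ts U 1%G Q.
Proof.
move=> sQG u_free; exists (sub1G Q), sQG; set K := 1%G.
have [us [us_free us_ortho]] := orthogonal_free_orbits sQG u_free.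
have [theta theta_inj] := poly_coordinates (univ_dim U).
set I := ind Q _; pose p (f : I) x := theta (val (f : ind_mod Q _) x).
(* The i-th basis vector of U, in the coset of x, goes to x^-1 us i. *)
pose phi (f : I) : U := \sum_(x in Q) act x^-1%g (lincomb us (p f x)).
have phi_lin : linear phi.
  move=> a f g; rewrite /phi scaler_sumr -big_split; apply: eq_bigr => x _ /=.
  by rewrite /p (val_ind_linear a (f : ind_mod Q _) g) !linearP.
pose phiL := GRing.isLinear.Build R _ _ *:%R phi phi_lin.
exists (HB.pack phi phiL : {linear I -> res sQG U}); split; last first.
  move=> h Qh f; rewrite /= /phi linear_sum (reindex_inj (mulIg h^-1%g)) /=.
  apply: eq_big => x; first by rewrite groupMr ?groupV.
  rewrite groupMr ?groupV // => Qx.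
  have -> : p (ind_act h f) (x * h^-1)%g = p f x.
    by rewrite /p val_ind_act // mulgKV.
  by rewrite invMg invgK rep_actM ?groupV ?(subsetP sQG).
apply: raddf_inj => f; rewrite /= => phi0.
(* [z i] is the component of [phi f] in the span of the orbit of [us i]. These components are
   pairwise orthogonal, so each vanishes with [phi f], and freeness then kills the coefficients. *)
pose z i := \sum_(x in Q) (p f x)`_i *: act x^-1%g (us i).
have z_ortho i j : i != j -> '[z i, z j] = 0.
  move=> neq; rewrite udot_sumr big1 // => y Qy.
  rewrite udotZr udotC udot_sumr big1 ?mulr0 // => x Qx.
  by rewrite udotZr udotC us_ortho ?groupV ?mulr0.
pose n := \max_(x in Q) size (p f x).
have le_n x : x \in Q -> (size (p f x) <= n)%N by apply: leq_bigmax_cond.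
have sum_z : \sum_(i < n) z i = 0.
  rewrite -[RHS]phi0 exchange_big; apply: eq_bigr => x Qx /=.
  rewrite (lincombE _ (le_n x Qx)) linear_sum.
  by apply: eq_bigr => i _; rewrite linearZ.
have p0 i x : x \in Q -> (p f x)`_i = 0.
  have [le_i Qx|lt_i Qx] := leqP n i.
    by rewrite nth_default // (leq_trans (le_n x Qx)).
  have zi0 : z i = 0.
    apply: udot_eq0.
    have: '[z i, \sum_(j < n) z j] = 0 by rewrite sum_z linear0r.
    rewrite udot_sumr (bigD1 (Ordinal lt_i)) //=.
    rewrite big1 ?addr0 // => j neq; rewrite z_ortho //.
    by apply: contraNneq neq => eqi; apply/eqP/val_inj.
  (* Since [phi] acts by inverses, the coefficients are reindexed by inversion before freeness
     applies. *)
  have := us_free i (fun y => (p f y^-1%g)`_i) _ x^-1%g.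
  rewrite invgK groupV; apply=> //; rewrite -[RHS]zi0 (reindex_inj invg_inj).
  by apply: eq_big => y; rewrite ?groupV // invgK.
apply: (@val_inj _ _ (ind_mod Q _)); apply/ffunP=> x; rewrite ffunE.
have [Qx|nQx] := boolP (x \in Q); last first.
  by have /ind_predP[->] := valP (f : ind_mod Q _).
apply: theta_inj; rewrite linear0; apply/polyP=> i; rewrite coef0.
exact: p0.
Qed.


Lemma isometries_of_act_nontrivial Q q v :
    Q \subset G -> (#|Q| <= 3)%N -> q \in Q -> act q v != v ->
  isometries_ts U 1%G Q.
Proof.
move=> sQG Q3 Qq qv; have [u u_free] := free_orbit_exists sQG Q3 Qq qv.
exact: isometries_of_free_orbit u_free.
Qed.

(** The induced function supported on [K] with value [t] at 1 vanishes at [h], so [h] moves it. An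
    equivariant injection carries this into [U]. *)
Lemma act_nontrivial_of_isometries (K H : {group gT}) h :
    isometries_ts U K H -> h \in H -> h \notin K ->
  exists v, act h v != v.
Proof.
case=> sKH [sHG [phi [phi_inj phi_act]]] Hh nKh.
have [t t0 _] := fixed_vector_exists.
set V := res (subset_trans sKH sHG) U in phi phi_inj phi_act *.
pose f : ind H V := ind_unit H (t : V).
exists (phi f); apply: contra t0 => /eqP e; apply/eqP.
have fixf : ind_act h f = f :> ind_mod H V.
  by apply: phi_inj; rewrite -[LHS]/(phi (rep_act (ind H V) h f)) phi_act.
have := val_ind_act f 1%g Hh.
rewrite fixf mul1g !(val_ind_unit sKH) (negPf nKh) group1.
by rewrite rep_act1.
Qed.

(** The isomorphism is evaluation at 1. *)
Lemma isometries_refl (H : {group gT}) : H \subset G -> isometries_ts U H H.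
Proof.
move=> sHG; exists (subxx H), sHG.
set V := res (subset_trans (subxx H) sHG) U.
pose phi (f : ind H V) : V := val (f : ind_mod H V) 1%g.
have phi_lin : linear phi.
  by move=> a f g; exact: (val_ind_linear a (f : ind_mod H V) g 1%g).
pose phiL := GRing.isLinear.Build R (ind H V) V *:%R phi phi_lin.
have phiE (f : ind H V) h :
    h \in H -> val (f : ind_mod H V) h = rep_act V h (phi f).
  move=> Hh; have /ind_predP[_ fH] := valP (f : ind_mod H V).
  by rewrite -[h in LHS]mulg1 fH.
exists (HB.pack phi phiL : {linear ind H V -> res sHG U}).
split=> [f g | h Hh f].
  move=> fg; apply: (@val_inj _ _ (ind_mod H V)); apply/ffunP=> x.
  have [Hx|nHx] := boolP (x \in H); first by rewrite !phiE // [phi f]fg.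
  have /ind_predP[f0 _] := valP (f : ind_mod H V).
  have /ind_predP[g0 _] := valP (g : ind_mod H V).
  by rewrite f0 // g0.
have := val_ind_act (f : ind_mod H V) 1%g Hh.
by rewrite mul1g (phiE f h Hh).
Qed.

End UniverseTheory.

(** * The transfer system of an element of prime order *)

Section ConjugatesOfPrimeOrder.
Variables (gT : finGroupType) (G : {group gT}) (c : gT).
Hypothesis pr_c : prime #[c].

Definition conj_cycle_ts (K H : {group gT}) : Prop :=
  K = H \/ K = 1%G /\ exists2 g, g \in G & H = (<[c]> :^ g)%G.

Lemma subgroup_of_conj_cycle (K : {group gT}) g :
  K \subset <[c]> :^ g -> K = 1%G \/ K = (<[c]> :^ g)%G.
Proof.
move=> sKC; have [/eqP K1|ntK] := eqVneq #|K| 1%N; [left | right].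
  by apply/val_inj/eqP; rewrite /= trivg_card1.
apply/val_inj/eqP; rewrite eqEcard sKC /= cardJg -orderE.
have := cardSg sKC; rewrite cardJg -orderE => /(prime_nt_dvdP pr_c ntK) ->.
exact: leqnn.
Qed.

(** Below a conjugate of [<[c]>] lie only that conjugate and 1, so restriction and saturation yield
    only identities and arrows already present. *)
Lemma saturated_conj_cycle_ts : saturated_ts G conj_cycle_ts.
Proof.
split; first split.
- by left.
- move=> K H _ _ [//|[K1 _]] [//|[H1 _]]; by rewrite K1 H1.
- move=> L K H _ _ _ [-> //|[-> LK]] [<-|[_ KH]]; first by right.
  by right.
- by move=> K H _ _ [->|[-> _]]; rewrite ?sub1G.
- move=> L K H _ _ _ [->|[-> [g Gg ->]]] sKH.
    by left; apply/val_inj/setIidPl.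
  have K1 : (K :&: 1)%G = 1%G by apply/val_inj; rewrite /= (setIidPr (sub1G K)).
  rewrite K1; have [->|->] := subgroup_of_conj_cycle sKH; first by left.
  by right; split=> //; exists g.
- move=> K H g _ _ Gg [->|[-> [h Gh ->]]]; first by left.
  right; split; first by apply/val_inj; rewrite /= conjs1g.
  exists (h * g^-1)%g; first by rewrite groupM ?groupV.
  by apply/val_inj; rewrite /= conjsgM.
move=> L K H sLK sKH _ [LH|[L1 [g Gg HE]]].
  by left; apply/val_inj/eqP; rewrite eqEsubset sKH /= -LH.
move: sKH; rewrite HE => /subgroup_of_conj_cycle[->|->]; last by left.
by right; split=> //; exists g.
Qed.

End ConjugatesOfPrimeOrder.

(** * A criterion for non-saturation *)

Lemma not_saturated_of_commutator (R : realType) (gT : finGroupType)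
    (G : {group gT}) (q y : gT) :
    q \in G -> y \in G -> (#[q] <= 3)%N -> prime #[[~ q, y]%g] ->
    #[q] != #[[~ q, y]%g] ->
  ~ saturated_group R G.
Proof.
move=> Gq Gy q3; set c := [~ q, y]%g => pr_c neq_qc satG.
have Gc : c \in G by rewrite groupR.
have [U U_T] := satG _ (saturated_conj_cycle_ts G pr_c).
have iso_c : isometries_ts U 1%G <[c]>%G.
  apply/U_T; rewrite ?sub1G ?cycle_subG //; right; split=> //; exists 1%g => //.
  by apply/val_inj; rewrite /= conjsg1.
have c1 : c \notin 1%G by rewrite inE -order_gt1 prime_gt1.
have [v cv] := act_nontrivial_of_isometries iso_c (cycle_id c) c1.
have [w qw] : exists w : U, rep_act U q w != w.
  (* [c] is the inverse of [q] times a conjugate of [q], so it acts trivially whenever [q] does. *)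
  apply: contrapT => q_triv; case/eqP: cv.
  have qfix w : rep_act U q w = w.
    by apply/eqP/contraT => qw; case: q_triv; exists w.
  have qVfix w : rep_act U q^-1%g w = w by rewrite -{1}(qfix w) actK.
  rewrite /c commgEl conjgE !rep_actM ?groupM ?groupV // qVfix qfix.
  by rewrite actK.
have iso_q : isometries_ts U 1%G <[q]>%G.
  by apply: isometries_of_act_nontrivial qw; rewrite ?cycle_subG ?cycle_id.
(* The arrow to [<[q]>] is an identity only if [q = 1], whence [c = 1]; otherwise [<[q]>] is
   conjugate to [<[c]>], against the orders. *)
have [|[_ [g Gg /(congr1 (fun H : {group gT} => #|H|))]]] :
    conj_cycle_ts G c 1%G <[q]>%G.
- by apply/U_T; rewrite ?sub1G ?cycle_subG.
- move/(congr1 val)/esym/eqP; rewrite /= cycle_eq1 => /eqP q1.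
  by move: c1; rewrite inE /c q1 comm1g eqxx.
- by rewrite /= cardJg -!orderE => /eqP; apply/negP.
Qed.

(** * Orders and commutators of permutations *)

Section Permutations.
Variables (T : finType) (a b c d : T).
Hypotheses (ab : a != b) (ac : a != c) (bc : b != c).

(** With s = (a b) and t = (a c), the cube of st is (sts)(tst), and both factors equal (b c). *)
Lemma order_tpermM : #[(tperm a b * tperm a c)%g] = 3.
Proof.
apply: nt_prime_order => //.
  have sts : (tperm a b * tperm a c * tperm a b = tperm b c)%g.
    by rewrite -{1}(tpermV a b) -mulgA -conjgE tpermJ tpermL tpermD.
  have tst : (tperm a c * tperm a b * tperm a c = tperm c b)%g.
    by rewrite -{1}(tpermV a c) -mulgA -conjgE tpermJ tpermL tpermD // eq_sym.
  rewrite 2!expgS expg1 !mulgA sts -!mulgA (mulgA (tperm a c)) tst.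
  by rewrite tpermC tperm2.
apply/eqP=> /permP/(_ b); rewrite permM tpermR tpermL perm1 => cb.
by case/eqP: bc.
Qed.

Lemma order_tperm : #[tperm a b] = 2.
Proof.
apply: nt_prime_order => //; first by rewrite expgS expg1 tperm2.
by apply/eqP=> /permP/(_ a)/eqP; rewrite tpermL perm1 eq_sym (negPf ab).
Qed.

Lemma commg_tperm : [~ tperm a b, tperm b c]%g = (tperm a b * tperm a c)%g.
Proof. by rewrite commgEl tpermV tpermJ tpermL tpermD // eq_sym. Qed.

Hypotheses (ad : a != d) (bd : b != d) (cd : c != d).

(** Conjugation by [y] turns the 3-cycle (a b)(a c) into (b a)(b d). Multiplied by the inverse (a
    c)(a b), the two inner transpositions cancel. *)
Lemma commg_tpermM :
  [~ tperm a b * tperm a c, tperm a b * tperm c d]%g = (tperm a c * tperm b d)%g.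
Proof.
pose y := (tperm a b * tperm c d)%g.
have ya : y a = b by rewrite permM tpermL tpermD // eq_sym.
have yb : y b = a by rewrite permM tpermR tpermD // eq_sym.
have yc : y c = d by rewrite permM (tpermD ac bc) tpermL.
rewrite commgEl invMg !tpermV conjMg !tpermJ -/y ya yb yc.
by rewrite (tpermC b a) -mulgA (mulgA (tperm a b)) tperm2 mul1g.
Qed.

Lemma order_tpermM_disjoint : #[(tperm a c * tperm b d)%g] = 2.
Proof.
apply: nt_prime_order => //.
  rewrite expgMn; last first.
    by apply/commgP; rewrite commgEl tpermV tpermJ !tpermD ?tperm2 // eq_sym.
  by rewrite 2!(expgS _ 1) !expg1 !tperm2 mulg1.
apply/eqP=> /permP/(_ a); rewrite permM tpermL (tpermD bc) ?perm1 => [ca|].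
  by case/eqP: ac.
by rewrite eq_sym.
Qed.

End Permutations.

(** * The standard dot product on polynomials *)

Section PolynomialDot.
Variable R : realType.
Implicit Types p q : {poly R}.

(** Written through [lincomb] so that linearity in [p] is inherited. *)
Definition pdot p q : R := lincomb (V := R^o) (fun i => q`_i) p.

Lemma pdotE n p q : (size p <= n)%N -> pdot p q = \sum_(i < n) p`_i * q`_i.
Proof. exact: (@lincombE R R^o (fun i => q`_i)). Qed.

Lemma pdotC p q : pdot p q = pdot q p.
Proof.
rewrite !(@pdotE (maxn (size p) (size q))) ?leq_max ?leqnn ?orbT //.
by apply: eq_bigr => i _; rewrite mulrC.
Qed.

Lemma pdotPl a p q r : pdot (a *: p + q) r = a * pdot p r + pdot q r.
Proof. exact: (linearP (lincomb (V := R^o) (fun i => r`_i))). Qed.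

Lemma pdot_ge0 p : 0 <= pdot p p.
Proof.
by rewrite (pdotE _ (leqnn _)); apply: sumr_ge0 => i _; rewrite -expr2 sqr_ge0.
Qed.

Lemma pdot_eq0 p : pdot p p = 0 -> p = 0.
Proof.
rewrite (pdotE _ (leqnn _)) => /eqP; rewrite psumr_eq0 => [/allP p0|i _];
  last by rewrite -expr2 sqr_ge0.
apply/eqP/contraT => pn0; rewrite -lead_coef_eq0 /lead_coef in pn0 *.
have lt_p : ((size p).-1 < size p)%N.
  by rewrite ltn_predL lt0n size_poly_eq0 -lead_coef_eq0.
have := p0 (Ordinal lt_p) (mem_index_enum _).
by rewrite /= mulf_eq0 orbb (negPf pn0).
Qed.

End PolynomialDot.

(** * The universe of a permutation action *)

Section PermutationUniverse.
Variables (R : realType) (gT : finGroupType) (G : {group gT}).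
Variables (X : finType) (x0 : X) (to : {action gT &-> X}).
Local Notation pmod := {ffun X -> {poly R}}.
Implicit Types f g : pmod.

(** No inverse appears: a right action on points is a left action on functions. Values in [{poly R}]
    rather than [R] give countably many copies of the permutation representation. *)
Definition perm_act (h : gT) f : pmod := [ffun x => f (to x h)].

Lemma perm_act_is_linear h : linear (perm_act h).
Proof. by move=> a u v; apply/ffunP=> x; rewrite !ffunE. Qed.

HB.instance Definition _ h :=
  GRing.isLinear.Build R pmod pmod *:%R (perm_act h) (perm_act_is_linear h).

Lemma perm_act1 f : perm_act 1%g f = f.
Proof. by apply/ffunP=> x; rewrite ffunE act1. Qed.

Lemma perm_actM :
  {in G &, forall h k f, perm_act (h * k)%g f = perm_act h (perm_act k f)}.
Proof. by move=> h k _ _ f; apply/ffunP=> x; rewrite !ffunE actM. Qed.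

Definition perm_rep : rep R G :=
  @Rep R gT G pmod (fun h => perm_act h : {linear _ -> _}) perm_act1 perm_actM.

Definition perm_dot f g : R := \sum_x pdot (f x) (g x).

Lemma perm_dotC f g : perm_dot f g = perm_dot g f.
Proof. by apply: eq_bigr => x _; apply: pdotC. Qed.

Lemma perm_dotPl a f g k :
  perm_dot (a *: f + g) k = a * perm_dot f k + perm_dot g k.
Proof.
rewrite /perm_dot mulr_sumr -big_split; apply: eq_bigr => x _ /=.
by rewrite !ffunE pdotPl.
Qed.

Lemma perm_dotPr a f g k :
  perm_dot k (a *: f + g) = a * perm_dot k f + perm_dot k g.
Proof. by rewrite !(perm_dotC k) perm_dotPl. Qed.

HB.instance Definition _ := @isBilinear.Build R pmod pmod R *%R (idfun \; *%R)
  perm_dot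
  (fun k => zmod_morphism_linear (fun a f g => perm_dotPl a f g k))
  (fun k => zmod_morphism_linear (fun a f g => perm_dotPr a f g k))
  (fun k => scalable_linear (fun a f g => perm_dotPl a f g k))
  (fun k => scalable_linear (fun a f g => perm_dotPr a f g k)).

Lemma perm_dot_hermitian f g :
  perm_dot f g = (-1) ^+ false * idfun (perm_dot g f).
Proof. by rewrite expr0 mul1r perm_dotC. Qed.

HB.instance Definition _ :=
  @isHermitianSesquilinear.Build R pmod false idfun perm_dot perm_dot_hermitian.

Lemma perm_dot_gt0 f : f != 0 -> 0 < perm_dot f f.
Proof.
move=> f0; rewrite lt_def sumr_ge0 ?andbT => [|x _]; last exact: pdot_ge0.
apply: contraNneq f0 => /eqP; rewrite psumr_eq0 => [/allP f0|x _];
  last exact: pdot_ge0.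
apply/eqP/ffunP=> x; rewrite ffunE; apply/pdot_eq0/eqP.
exact: (f0 x (mem_index_enum _)).
Qed.

HB.instance Definition _ := @isDotProduct.Build R pmod perm_dot perm_dot_gt0.

Lemma perm_dot_act :
  {in G, forall h f g, perm_dot (perm_act h f) (perm_act h g) = perm_dot f g}.
Proof.
move=> h _ f g; rewrite [RHS](reindex_inj (act_inj to h)).
by apply: eq_bigr => x _; rewrite !ffunE.
Qed.

Lemma perm_dim : countably_infinite_dimensional perm_rep.
Proof.
pose m := #|X|; have m_gt0 : (0 < m)%N by apply/card_gt0P; exists x0.
(* Division of [k] by [m] gives the exponent as quotient and the point as remainder; [K x i] is the
   index of the monomial of degree [i] at [x]. *)
pose e k : pmod :=
  [ffun x => if (k %% m)%N == enum_rank x then 'X^(k %/ m)%N else 0].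
pose K (x : X) i := (i * m + enum_rank x)%N.
have eE k x i : (e k x)`_i = (k == K x i)%:R.
  rewrite ffunE; have [km|km] := eqVneq.
    rewrite coefXn eq_sym [k in RHS](divn_eq k m) km /K eqn_add2r.
    by rewrite eqn_pmul2r.
  rewrite coef0; have [kE|//] := eqVneq.
  by rewrite kE /K modnMDl modn_small ?ltn_ord ?eqxx in km.
have combE n (c : 'I_n -> R) x i : ((\sum_(k < n) c k *: e k) x)`_i =
    \sum_(k < n | val k == K x i) c k.
  rewrite sum_ffunE coef_sum [RHS]big_mkcond; apply: eq_bigr => k _.
  by rewrite ffunE coefZ eE; case: eqP => _; rewrite ?mulr1 ?mulr0.
exists e; split=> [n c ce0 k | f].
  pose x := enum_val (Ordinal (ltn_pmod k m_gt0)).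
  have kE : K x (k %/ m)%N = k by rewrite /K enum_valK -divn_eq.
  have := combE n c x (k %/ m)%N; rewrite ce0 ffunE coef0 kE.
  by rewrite (big_pred1 k) // => k'; rewrite -val_eqE.
pose d := \max_x size ((f : pmod) x); exists (d * m)%N.
pose c k := ((f : pmod) (enum_val (Ordinal (ltn_pmod k m_gt0))))`_(k %/ m)%N.
exists (fun k => c (val k)); apply/ffunP=> x; apply/polyP=> i; rewrite combE.
have cK : c (K x i) = ((f : pmod) x)`_i.
  rewrite /c /K divnMDl // divn_small ?ltn_ord // addn0.
  congr (((f : pmod) _)`_i).
  apply: enum_rank_inj; rewrite enum_valK; apply: val_inj => /=.
  by rewrite modnMDl modn_small ?ltn_ord.
rewrite -cK; have [lt_i|le_i] := ltnP i d.
  have ltK : (K x i < d * m)%N.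
    rewrite /K (@leq_trans (i.+1 * m)) ?leq_mul2r ?lt_i ?orbT //.
    by rewrite mulSn addnC ltn_add2r ltn_ord.
  by rewrite (big_pred1 (Ordinal ltK)) // => k; rewrite -val_eqE.
rewrite big_pred0 => [|k].
  by rewrite cK nth_default // (leq_trans _ le_i) // (leq_bigmax x).
apply/negbTE; apply: contraTneq (ltn_ord k) => ->.
by rewrite -leqNgt /K (leq_trans _ (leq_addr _ _)) // leq_mul2r le_i orbT.
Qed.

Definition const_pred : {pred pmod} :=
  [pred f : pmod | [forall x, f x == f x0]].

Lemma const_predP f : reflect (forall x, f x = f x0) (f \in const_pred).
Proof. exact: forallPP (fun x => eqP). Qed.

Lemma const_submod_closed : submod_closed const_pred.
Proof.
split=> [|a f g /const_predP fc /const_predP gc]; apply/const_predP=> x.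
  by rewrite !ffunE.
by rewrite !ffunE fc gc.
Qed.

HB.instance Definition _ :=
  GRing.isSubmodClosed.Build R pmod const_pred const_submod_closed.

Lemma perm_trivial : exists S : submodClosed perm_rep,
    [/\ stable S, exists2 v, v \in S & v != 0
      & {in G, forall h v, v \in S -> rep_act perm_rep h v = v}].
Proof.
have fixc h f : f \in const_pred -> perm_act h f = f.
  by move=> /const_predP fc; apply/ffunP=> x; rewrite ffunE fc [RHS]fc.
exists (const_pred : submodClosed perm_rep); split.
- by move=> h Gh f cf; rewrite /= fixc.
- exists [ffun=> 1]; first by apply/const_predP=> x; rewrite !ffunE.
  by apply/eqP=> /ffunP/(_ x0)/eqP; rewrite !ffunE oner_eq0.
- by move=> h Gh f cf; apply: fixc.
Qed.

(* n polynomials are interleaved into a single one. *)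
Lemma perm_pow (S : submodClosed perm_rep) (stS : stable S) :
    finite_dimensional (subrep stS) ->
  forall n : nat, embeds (pow (subrep stS) n) perm_rep.
Proof.
move=> _ n.
pose phi (w : {ffun 'I_n -> subsp S}) : pmod :=
  [ffun x => \sum_(i < n) 'X^i * ((val (w i) : pmod) x \Po 'X^n)].
have phi_lin : linear phi.
  move=> a u v; apply/ffunP=> x; rewrite !ffunE scaler_sumr -big_split.
  apply: eq_bigr => i _ /=.
  have -> : (a *: u + v) i = a *: u i + v i by rewrite !ffunE.
  have -> : sval (a *: u i + v i) = a *: sval (u i) + sval (v i) :> pmod.
    exact: (linearP (val : {linear subsp S -> perm_rep})).
  rewrite !ffunE comp_polyD comp_polyZ.
  by rewrite mulrDr scalerAr.
pose phiL := GRing.isLinear.Build R _ _ *:%R phi phi_lin.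
exists (HB.pack phi phiL : {linear pow (subrep stS) n -> perm_rep}).
(* The residue of an exponent modulo [n] names the polynomial and the quotient its degree there, so
   [phi w] determines [w]. *)
have phiE w x (j : 'I_n) k :
    (phi w x)`_(k * n + j)%N = ((val (w j) : pmod) x)`_k.
  have n_gt0 : (0 < n)%N by apply: leq_ltn_trans (ltn_ord j).
  rewrite ffunE coef_sum (bigD1 j) //= big1 => [|i neq].
    rewrite coefXnM ltnNge leq_addl addnK coef_comp_poly_Xn //.
    by rewrite dvdn_mull // mulnK // addr0.
  rewrite coefXnM; case: ltnP => // le_i; rewrite coef_comp_poly_Xn //.
  case: ifP => // n_dvd; case/eqP: neq; apply: val_inj.
  have := n_dvd; rewrite -eqn_mod_dvd // modnMDl !modn_small ?ltn_ord //.
  by move/eqP.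
split=> [v w vw | h Gh w].
  apply/ffunP=> j; apply/val_inj/ffunP=> x; apply/polyP=> k.
  by rewrite -!phiE; congr (((_ : pmod) x)`__).
apply/ffunP=> x; rewrite !ffunE; apply: eq_bigr => i _.
rewrite ffunE; have -> : val (rep_act (subrep stS) h (w i) : subsp S) =
    perm_act h (val (w i)) by exact: val_sub_act.
by rewrite ffunE.
Qed.

Definition perm_universe : universe R G :=
  @Universe R gT G perm_rep perm_dot perm_dot_act perm_dim perm_trivial perm_pow.

End PermutationUniverse.

(** * Groups of order at most 3 are saturated *)

Section SmallGroups.
Variables (R : realType) (gT : finGroupType) (G : {group gT}).

Lemma fixing_is_action : is_action [set: gT] (fun (x : unit) (_ : gT) => x).
Proof. by split=> [g [] [] | []]. Qed.

Lemma saturated_of_card_le3 : (#|G| <= 3)%N -> saturated_group R G.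
Proof.
move=> G3 T [tsT _].
(* Only the arrow from 1 to a nontrivial [G] has to be matched; all others are decided by
   reflexivity and inclusion. *)
have [U U1G] : exists U : universe R G,
    G != 1%G -> (T 1%G G <-> isometries_ts U 1%G G).
  have [G1|/trivgPn[q Gq q1]] := eqVneq (G : {set gT}) 1%g.
    exists (perm_universe R G tt (Action fixing_is_action)).
    by move/eqP; case; apply: val_inj.
  have [T1G|nT1G] := pselect (T 1%G G).
    pose U := perm_universe R G 1%g (mulgr_action gT).
    exists U => _; split=> // _.
    (* The indicator of 1 in the regular representation is moved by [q]. *)
    pose v : U := [ffun x : gT => (x == 1%g)%:R] : {ffun gT -> {poly R}}.
    apply: (isometries_of_act_nontrivial (v := v) (subxx G) G3 Gq).
    apply/eqP=> /ffunP/(_ 1%g)/eqP; rewrite !ffunE /= mul1g eqxx (negPf q1).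
    by rewrite eq_sym oner_eq0.
  exists (perm_universe R G tt (Action fixing_is_action)) => _; split=> // iso.
  have q1G : q \notin 1%G by rewrite inE.
  have [v /eqP[]] := act_nontrivial_of_isometries iso Gq q1G.
  by apply/ffunP=> x; rewrite ffunE.
exists U => K H sKG sHG.
have [->|neq] := eqVneq K H.
  by split=> _; [apply: isometries_refl | apply: (ts_refl tsT)].
have [K1|KG] := subgroup_of_card_le3 G3 sKG; last first.
  have sub_false : K \subset H -> False.
    move=> sKH; case/eqP: neq; apply/val_inj/eqP.
    by rewrite eqEsubset sKH /= KG.
  split=> [/(ts_sub tsT sKG sHG)/sub_false | [/sub_false]] //.
have [H1|HG] := subgroup_of_card_le3 G3 sHG.
  by rewrite K1 H1 eqxx in neq.
by rewrite K1 HG; apply: U1G; rewrite -HG -K1 eq_sym.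
Qed.

End SmallGroups.

(** * Symmetric and alternating groups *)

Lemma not_saturated_Sym (R : realType) (T : finType) :
  (2 < #|T|)%N -> ~ saturated_group R 'Sym_T%G.
Proof.
move=> T3; pose i k (k3 : (k < 3)%N) : T :=
  enum_val (Ordinal (leq_trans k3 T3)).
pose a := @i 0%N isT; pose b := @i 1%N isT; pose c := @i 2 isT.
have [ab ac bc] : [/\ a != b, a != c & b != c].
  by split; rewrite (inj_eq enum_val_inj).
apply: (@not_saturated_of_commutator _ _ _ (tperm a b) (tperm b c));
  by rewrite ?in_setT // ?commg_tperm ?order_tpermM ?order_tperm.
Qed.

Lemma not_saturated_Alt (R : realType) (T : finType) :
  (3 < #|T|)%N -> ~ saturated_group R 'Alt_T%G.
Proof.
move=> T4; pose i k (k4 : (k < 4)%N) : T :=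
  enum_val (Ordinal (leq_trans k4 T4)).
pose a := @i 0%N isT; pose b := @i 1%N isT; pose c := @i 2 isT.
pose d := @i 3 isT.
have [ab ac ad] : [/\ a != b, a != c & a != d].
  by split; rewrite (inj_eq enum_val_inj).
have [bc bd cd] : [/\ b != c, b != d & c != d].
  by split; rewrite (inj_eq enum_val_inj).
apply: (@not_saturated_of_commutator _ _ _
    (tperm a b * tperm a c)%g (tperm a b * tperm c d)%g);
  by rewrite ?Alt_even ?odd_permM ?odd_tperm ?commg_tpermM ?order_tpermM
    ?order_tpermM_disjoint ?ab ?ac ?cd.
Qed.

(** The order of the alternating group is half of n! only for n at least 2, so small n is treated
    apart. *)
Lemma card_Alt_le3 n : (n <= 3)%N -> (#|'Alt_('I_n)| <= 3)%N.
Proof.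
move=> n3; have [n2|n2] := leqP n 2.
  by rewrite trivial_Alt_2 ?card_ord // cards1.
rewrite -(@leq_pmul2l 2) // card_Alt ?card_ord ?(ltnW n2) //.
by have -> : n = 3 by apply/eqP; rewrite eqn_leq n3.
Qed.

Lemma card_Sym_le3 n : (n <= 2)%N -> (#|'Sym_('I_n)| <= 3)%N.
Proof. by rewrite card_Sym card_ord; case: n => [|[|[|]]]. Qed.

End Development.

Theorem theorem4 (R : realType) :
  (forall n : nat, saturated_group R 'Sym_('I_n) <-> n <= 2) /\
  (forall m : nat, saturated_group R 'Alt_('I_m) <-> m <= 3).
Proof.
split=> n; split.
- move=> satG; rewrite leqNgt -[n in _ < n]card_ord.
  by apply/negP => /(not_saturated_Sym (R := R)).
- by move/card_Sym_le3/saturated_of_card_le3.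
- move=> satG; rewrite leqNgt -[n in _ < n]card_ord.
  by apply/negP => /(not_saturated_Alt (R := R)).
- by move/card_Alt_le3/saturated_of_card_le3.
Qed.
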